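(* Let $G$ be a simple loopless graph on the vertex set $[L]=\{1,\dots,L\}$ and let $(s_i)_{i=1}^{L}$ be a collection of $G$-independent semicircle variables in a $C^*$-probability space $(\mathcal{A},\tau)$ with faithful tracial state $\tau$. For any complex numbers $\alpha_1,\dots,\alpha_L$ and any integer $p\ge 1$, \[ \Big\|\sum_{i=1}^{L}\alpha_i s_i\Big\|_{2p}\le C_p^{\frac{1}{2p}}\min\Big\{\sum_{i=1}^{L}|\alpha_i|^2\,|c^*(i)|,\; p\sum_{i=1}^{L}|\alpha_i|^2\Big\}^{1/2}, \] where $|c^*(i)|$ is the size of the largest clique in $G$ containing $i$. In particular, \[ \Big\|\sum_{i=1}^{L}\alpha_i s_i\Big\|_{2p}\le C_p^{\frac{1}{2p}}\sqrt{\min(\omega(G),p)}\,\Big(\sum_{i=1}^{L}|\alpha_i|^2\Big)^{1/2}, \] where $\omega(G)$ is the clique number of $G$.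
   Context: $(\mathcal{A},\tau)$ is a unital $C^*$-algebra with a faithful tracial state $\tau$. For $u\in\mathcal{A}$, $\|u\|_{2p}:=\tau((uu^* )^p)^{1/(2p)}$. $C_p=\frac{1}{p+1}\binom{2p}{p}$ is the $p$-th Catalan number. A semicircle variable is a self-adjoint element whose distribution under $\tau$ is the standard semicircle law (density $\frac{1}{2\pi}\sqrt{4-x^2}$ on $[-2,2]$). Given a simple loopless graph $G$ on $[L]$, unital subalgebras $\mathcal{A}_1,\dots,\mathcal{A}_L\subset\mathcal{A}$ are $G$-independent if: (i) for every edge $(i,j)\in E(G)$, $\mathcal{A}_i$ and $\mathcal{A}_j$ are classically independent (they commute, and $\tau(ab)=\tau(a)\tau(b)$-type factorization holds; in particular mixed products of centered elements from distinct commuting algebras have trace zero); (ii) for every $k\ge1$ and index sequence $(i_1,\dots,i_k)\in[L]^k$ such that whenever $i_{j_1}=i_{j_2}$ with $j_1<j_2$ there is $j_3$ with $j_1<j_3<j_2$ and $(i_{j_1},i_{j_3})\notin E(G)$, one has $\tau(a_1\cdots a_k)=0$ for all $a_j\in\mathcal{A}_{i_j}$ with $\tau(a_j)=0$. Variables $s_1,\dots,s_L$ are $G$-independent if the unital $*$-subalgebras they generate are. Edges of $G$ thus correspond to classically independent (commuting) pairs and non-edges to free pairs. *)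

(* Defs.v *)
From HB Require Import structures.
From mathcomp Require Import all_boot all_order all_algebra.
From mathcomp Require Import all_classical all_reals all_analysis.
From mathcomp Require Import complex.

Set Implicit Arguments.
Unset Strict Implicit.
Unset Printing Implicit Defensive.

Import Order.TTheory GRing.Theory Num.Theory.
Local Open Scope ring_scope.

Definition absC2 (R : realType) (z : R[i]) : R :=
  complex.Re z ^+ 2 + complex.Im z ^+ 2.

Record CStarProb (R : realType) (A : lalgType R[i]) : Type := {
  star : A -> A;
  star_add : forall x y, star (x + y) = star x + star y;
  star_scale : forall (c : R[i]) x, star (c *: x) = c^* *: star x;
  star_mul : forall x y, star (x * y) = star y * star x;
  star_invol : forall x, star (star x) = x;
  cnorm : A -> R;
  cnorm_ge0 : forall x, 0 <= cnorm x;
  cnorm_eq0 : forall x, cnorm x = 0 -> x = 0;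
  cnorm_triangle : forall x y, cnorm (x + y) <= cnorm x + cnorm y;
  cnorm_scale : forall (c : R[i]) x, cnorm (c *: x) = Num.sqrt (absC2 c) * cnorm x;
  cnorm_submul : forall x y, cnorm (x * y) <= cnorm x * cnorm y;
  cnorm_cstar : forall x, cnorm (star x * x) = cnorm x ^+ 2;
  cnorm_complete : forall u : nat -> A,
    (forall e : R, 0 < e -> exists N, forall m n, (N <= m)%N -> (N <= n)%N ->
        cnorm (u m - u n) < e) ->
    exists l : A, forall e : R, 0 < e -> exists N, forall n, (N <= n)%N ->
        cnorm (u n - l) < e;
  tau : A -> R[i];
  tau_add : forall x y, tau (x + y) = tau x + tau y;
  tau_scale : forall (c : R[i]) x, tau (c *: x) = c * tau x;
  tau1 : tau 1 = 1;
  tau_pos : forall x, 0 <= tau (star x * x);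
  tau_faithful : forall x, tau (star x * x) = 0 -> x = 0;
  tau_trace : forall x y, tau (x * y) = tau (y * x)
}.
Arguments CStarProb : clear implicits.

Section Defs.
Variables (R : realType) (A : lalgType R[i]) (S : CStarProb R A).

Definition word (x : A) (w : seq bool) : A :=
  \prod_(b <- w) (if b then star S x else x).

Definition gen_star_alg (x : A) (a : A) : Prop :=
  exists (n : nat) (c : 'I_n -> R[i]) (w : 'I_n -> seq bool),
    a = \sum_(j < n) c j *: word x (w j).

Definition G_independent (L : nat) (E : rel 'I_L) (Alg : 'I_L -> A -> Prop) : Prop :=
  (forall i j : 'I_L, E i j -> forall a b : A, Alg i a -> Alg j b ->
      a * b = b * a /\ tau S (a * b) = tau S a * tau S b) /\
  (forall (k : nat) (idx : 'I_k -> 'I_L) (a : 'I_k -> A),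
      (0 < k)%N ->
      (forall j1 j2 : 'I_k, (j1 < j2)%N -> idx j1 = idx j2 ->
          exists j3 : 'I_k, (j1 < j3 < j2)%N /\ ~~ E (idx j1) (idx j3)) ->
      (forall j : 'I_k, Alg (idx j) (a j) /\ tau S (a j) = 0) ->
      tau S (\prod_(j < k) a j) = 0).

Definition semicircular (s : A) : Prop :=
  star S s = s /\
  forall k : nat, tau S (s ^+ k) =
    Complex (\int[lebesgue_measure]_(x in `[(-2 : R), 2]%classic)
               (x ^+ k * Num.sqrt (4 - x ^+ 2) / (2 * pi))) 0.

Definition norm2p (u : A) (p : nat) : R :=
  complex.Re (tau S ((u * star S u) ^+ p)) `^ (p.*2%:R)^-1.

End Defs.

Definition catalan (R : realType) (p : nat) : R := ('C(p.*2, p))%:R / (p.+1)%:R.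

Definition clique (L : nat) (E : rel 'I_L) (K : {set 'I_L}) : bool :=
  [forall x in K, forall y in K, (x != y) ==> E x y].

Definition maxclique_at (L : nat) (E : rel 'I_L) (i : 'I_L) : nat :=
  \max_(K : {set 'I_L} | clique E K && (i \in K)) #|K|.

Definition clique_number (L : nat) (E : rel 'I_L) : nat :=
  \max_(K : {set 'I_L} | clique E K) #|K|.

(* Main.v *)
(* Expand tau ((X X^* )^p) by letting the letters s_i act one at a time on
   products of Chebyshev polynomials U_n(s_i) taken along a reduced sequence of
   blocks. Since s_i U_n(s_i) = U_(n+1)(s_i) + U_(n-1)(s_i) and s_i commutes
   with its neighbours, each s_i adds a letter i to the product and, if i can be
   commuted to the front, alternatively removes one; tau kills every nonempty
   product by G-independence. So tau is a sum over Dyck paths, of which there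
   are C_p, decorated by the letter removed at each descent. The removable
   letters are pairwise adjacent, hence form a clique, and there are at most as
   many as the height of the path, which is at most p. Weighting a removal of i
   by 1 / |c^*(i)|, or by 1 / p, makes the weights of the possible removals at
   each descent sum to at most 1; the bound follows. *)
Require Import Defs.
From HB Require Import structures.
From mathcomp Require Import all_boot all_order all_algebra.
From mathcomp Require Import all_classical all_reals all_analysis.
From mathcomp Require Import complex.
From mathcomp Require Import ring lra zify.

Set Implicit Arguments.
Unset Strict Implicit.
Unset Printing Implicit Defensive.

Import Order.TTheory GRing.Theory Num.Theory.
Import numFieldNormedType.Exports.
Local Open Scope ring_scope.

(** * Chebyshev polynomials U_n(x / 2), over any ring so as to serve both reals and operators *)

Fixpoint cheb (K : nzRingType) (x : K) (n : nat) : K :=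
  match n with
  | 0 => 1
  | n'.+1 => match n' with 0 => x | n''.+1 => x * cheb x n' - cheb x n'' end
  end.

Lemma chebSS (K : nzRingType) (x : K) n :
  cheb x n.+2 = x * cheb x n.+1 - cheb x n.
Proof. by []. Qed.

Arguments cheb : simpl never.

Lemma mul_cheb (K : nzRingType) (x : K) n :
  x * cheb x n.+1 = cheb x n.+2 + cheb x n.
Proof. by rewrite chebSS subrK. Qed.

Lemma nat_ind2 (P : nat -> Prop) :
  P 0%N -> P 1%N -> (forall n, P n -> P n.+1 -> P n.+2) -> forall n, P n.
Proof.
move=> P0 P1 PS n; suff [] : P n /\ P n.+1 by [].
by elim: n => // n [? ?]; split => //; exact: PS.
Qed.

(** * Integration of Chebyshev polynomials against the semicircle law *)

Section ChebReal.
Variable R : realType.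
Implicit Types x : R.

Fixpoint dcheb (x : R) (n : nat) : R :=
  match n with
  | 0 => 0
  | n'.+1 => match n' with
             | 0 => 1
             | n''.+1 => cheb x n' + x * dcheb x n' - dcheb x n'' end
  end.

Lemma dchebSS x n : dcheb x n.+2 = cheb x n.+1 + x * dcheb x n.+1 - dcheb x n.
Proof. by []. Qed.

Arguments dcheb : simpl never.

Lemma is_derive_cheb x n :
  is_derive x (1 : R) (fun y : R => cheb y n) (dcheb x n).
Proof.
elim/nat_ind2: n => [|| n IH0 IH1].
- exact: is_derive_cst.
- exact: is_derive_id.
- have rec (f g : R -> R) f' g' : is_derive x (1 : R) f f' ->
      is_derive x (1 : R) g g' ->
      is_derive x (1 : R) (fun y => y * g y - f y) (g x + x * g' - f').
    by move=> ? ?; apply: is_derive_eq; rewrite /GRing.scale /=; ring.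
  exact: rec IH0 IH1.
Qed.

Lemma continuous_cheb n : continuous (fun y : R => cheb y n).
Proof.
move=> x; apply/differentiable_continuous; apply/derivable1_diffP.
by have [] := is_derive_cheb x n.
Qed.

(* With x = 2 cos t, both sides are sqrt (4 - x^2) times the derivative in x of
   sqrt (4 - x^2) U_n(x) = 2 sin ((n + 1) t). *)
Lemma cheb_ode x n :
  (4 - x ^+ 2) * dcheb x n - x * cheb x n =
  - n.+1%:R * (2 * cheb x n.+1 - x * cheb x n).
Proof.
elim/nat_ind2: n => [|| n IH0 IH1].
- by rewrite /cheb /dcheb; ring.
- by rewrite /cheb /dcheb; ring.
- move: IH0 IH1; rewrite dchebSS !chebSS.
  set a := cheb x n; set b := cheb x n.+1.
  set d1 := dcheb x n.+1; set d0 := dcheb x n.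
  rewrite -[n.+3]addn3 -[n.+2]addn2 -[n.+1]addn1 !natrD => IH0 IH1.
  have -> : (4 - x ^+ 2) * (b + x * d1 - d0) - x * (x * b - a) =
    (4 - x ^+ 2) * b + x * ((4 - x ^+ 2) * d1 - x * b)
    - ((4 - x ^+ 2) * d0 - x * a) by ring.
  by rewrite IH0 IH1; ring.
Qed.

Definition semicircle_density x : R := Num.sqrt (4 - x ^+ 2) / (2 * pi).

Lemma continuous_sqrt4 : continuous (fun x => Num.sqrt (4 - x ^+ 2)).
Proof.
move=> x; apply: (@continuous_comp _ _ _ (fun x => 4 - x ^+ 2) Num.sqrt);
  last exact: sqrt_continuous.
by apply: cvgB; [exact: cvg_cst | exact: exprn_continuous].
Qed.

Lemma integrable_density (f : R -> R) : continuous f ->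
  lebesgue_measure.-integrable `[(-2 : R), 2]%classic
    (EFin \o (fun x => f x * semicircle_density x)).
Proof.
move=> cf; apply: continuous_compact_integrable; first exact: segment_compact.
apply: continuous_subspaceT => x.
apply: cvgM; first exact: cf.
by apply: cvgM; [exact: continuous_sqrt4 | exact: cvg_cst].
Qed.

Lemma integral_cheb n :
  \int[lebesgue_measure]_(x in `[(-2 : R), 2]%classic)
    (cheb x n.+1 * semicircle_density x) = 0.
Proof.
(* With x = 2 cos t the integrand is a multiple of sin ((n + 2) t) sin t, that is, of cos ((n + 1)
   t) - cos ((n + 3) t). Integrating gives sin ((n + 3) t) / (n + 3) - sin ((n + 1) t) / (n + 1),
   which [F] writes back in x. *)
pose Q x := cheb x n.+2 / n.+3%:R - cheb x n / n.+1%:R.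
pose F x : R := (2 * pi)^-1 * (Num.sqrt (4 - x ^+ 2) * Q x).
have cQ : continuous Q.
  move=> x; apply: cvgB; apply: cvgM;
    solve [exact: continuous_cheb | exact: cvg_cst].
have cF : continuous F.
  move=> x; apply: cvgM; first exact: cvg_cst.
  by apply: cvgM; [exact: continuous_sqrt4 | exact: cQ].
have dF x : x \in `](-2), 2[ ->
    is_derive x (1 : R) F (cheb x n.+1 * semicircle_density x).
  rewrite in_itv /= => /andP[x1 x2].
  have x4 : 0 < 4 - x ^+ 2 by nra.
  have dS : is_derive x (1 : R) (fun y : R => Num.sqrt (4 - y ^+ 2))
      (- x / Num.sqrt (4 - x ^+ 2)).
    have H := is_derive1_sqrt x4.
    have H2 : is_derive x (1 : R) (fun y : R => 4 - y ^+ 2) (- 2 * x).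
      by apply: is_derive_eq; rewrite /GRing.scale /=; ring.
    have := @is_derive1_comp _ Num.sqrt (fun y : R => 4 - y ^+ 2) x _ _ H H2.
    move=> H3; apply: is_derive_eq; rewrite invfM.
    by field; rewrite sqrtr_eq0 -ltNge.
  have d0 := is_derive_cheb x n; have d2 := is_derive_cheb x n.+2.
  apply: is_derive_eq.
  rewrite /GRing.scale /= /semicircle_density /Q.
  have o0 := cheb_ode x n; have o2 := cheb_ode x n.+2.
  set r : R := Num.sqrt (4 - x ^+ 2).
  have r0 : r != 0 by rewrite sqrtr_eq0 -ltNge.
  have rr : r ^+ 2 = 4 - x ^+ 2 by rewrite sqr_sqrtr // ltW.
  have [] : n.+1%:R != 0 :> R /\ n.+3%:R != 0 :> R by rewrite !pnatr_eq0.
  move=> n1 n3.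
    rewrite !mulr0 !add0r; move: r r0 rr => r r0 rr.
  (* Regrouped so that [cheb_ode] applies to both brackets and cancels the denominators n + 1 and n
     + 3. *)
  have alg (c0 c2 e0 e2 a b : R) : a != 0 -> b != 0 ->
      r * (a^-1 * e0 - b^-1 * e2) + (c0 / a - c2 / b) * (- x / r) =
      r^-1 * (a^-1 * (r ^+ 2 * e0 - x * c0) - b^-1 * (r ^+ 2 * e2 - x * c2)).
    by move=> a0 b0; field; rewrite r0 a0 b0.
  rewrite alg // rr o0 o2 !mulNr !mulrN !mulKf // !chebSS.
  move: (cheb x n) (cheb x n.+1) => u v.
  have -> : - (2 * (x * (x * v - u) - v) - x * (x * v - u))
      - - (2 * v - x * u) =
    v * (4 - x ^+ 2) by ring.
  by rewrite -rr; move: (2 * pi)^-1 => c; field.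
rewrite /Rintegral (@continuous_FTC2 _ _ F).
(* The square root factor of [F] vanishes at both endpoints. *)
- have e : 4 - 2 ^+ 2 = 0 :> R by ring.
  by rewrite /F sqrrN e sqrtr0 !(mul0r, mulr0) /= subrr.
- lra.
- apply: continuous_subspaceT => x; apply: cvgM; first exact: continuous_cheb.
  by apply: cvgM; [exact: continuous_sqrt4 | exact: cvg_cst].
- split; first by move=> x /dF [].
  + exact: cvg_at_right_filter (cF _).
  + exact: cvg_at_left_filter (cF _).
- by move=> x xI; rewrite derive1E; have := dF x xI => -[_ ->].
Qed.

End ChebReal.

(** * Counting Dyck paths *)

(** The number of paths of [k] unit steps from height [h] to 0 that never go below 0. *)
Fixpoint ballot (k h : nat) : nat :=
  match k with
  | 0 => h == 0
  | k'.+1 => ballot k' h.+1 + (if h is h'.+1 then ballot k' h' else 0)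
  end.

Lemma ballot_lt k h : (k < h)%N -> ballot k h = 0%N.
Proof.
elim: k h => [|k IH] [|h] //= kh.
by rewrite !IH //; lia.
Qed.

(** Reflection principle: j steps go up, and the paths reaching -1 number 'C(h + 2j, j - 1). The sum
    form avoids truncated subtraction; the case j = 0 stands for a zero binomial. *)
Lemma ballotE h j :
  (ballot (h + j.*2) h + (if j is j'.+1 then 'C(h + j.*2, j') else 0) =
   'C(h + j.*2, j))%N.
Proof.
move: {2}(h + j.*2)%N (erefl (h + j.*2)%N) => k.
elim: k h j => [|k IH] h j e.
  by have [-> ->] : h = 0%N /\ j = 0%N by lia.
have eS : (h + j.*2)%N = k.+1 := e.
rewrite eS /=.
have up : (ballot k h.+1 + (if j is j'.+1 then
      (if j' is j''.+1 then 'C(k, j'') else 0) else 0) =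
      if j is j'.+1 then 'C(k, j') else 0)%N.
  case: j e {eS} => [|j] e; first by rewrite ballot_lt //; lia.
  have ek : (h.+1 + j.*2)%N = k by lia.
  by have := IH _ _ ek; rewrite ek.
case: h e eS up => [|h] e eS up.
  case: j e eS up => [|j] e eS up; first by lia.
  rewrite binS addn0.
  (* At height 0 only the upward step exists; here k = 2j + 1, so the two central binomials
     agree. *)
  have -> : 'C(k, j.+1) = 'C(k, j).
    by rewrite -[RHS]bin_sub; [congr 'C(_, _) | ]; lia.
  by case: j up {e eS} => [|j] up; rewrite ?binS ?bin0 in up *; lia.
have ek : (h + j.*2)%N = k by lia.
have := IH _ _ ek; rewrite ek.
by case: j up {e eS ek} => [|[|j]] up; rewrite ?binS ?bin0 in up *; lia.
Qed.

Lemma ballot0_catalan (R : realType) p : (ballot p.*2 0)%:R = catalan R p.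
Proof.
rewrite /catalan; apply: (canRL (mulfK _)); first by rewrite pnatr_eq0.
rewrite -natrM; congr (_%:R).
have := ballotE 0 p; rewrite add0n.
case: p => [|p]; first by rewrite /= bin0.
have := mul_bin_left p.+1.*2 p.
have -> : (p.+1.*2 - p)%N = p.+2 by lia.
by nia.
Qed.

(** * Combinatorics of reduced block sequences *)

Section Blocks.
Variables (I : finType) (E : rel I).
Hypotheses (Esym : symmetric E) (Eirr : irreflexive E).
Implicit Types (i j : I) (l : seq (I * nat)).

(* The list [:: (i1, n1); ...; (ir, nr)] encodes the product
   U_(n1 + 1)(s_i1) ... U_(nr + 1)(s_ir) of Chebyshev polynomials. *)
Fixpoint exposed i l : bool :=
  if l is b :: l' then (b.1 == i) || E i b.1 && exposed i l' else false.

(** A letter is exposed if it can be commuted to the front. Reducedness thus says that no block can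
    be commuted next to an earlier block of the same letter. *)
Fixpoint reduced l : bool :=
  if l is b :: l' then ~~ exposed b.1 l' && reduced l' else true.

Fixpoint incr i l :=
  if l is (j, n) :: l' then
    if j == i then (j, n.+1) :: l' else (j, n) :: incr i l'
  else [::].

(** A block with second entry 0 encodes U_1, so lowering it leaves U_0 = 1 and the block
    disappears. *)
Fixpoint decr i l :=
  if l is (j, n) :: l' then
    if j == i then (if n is n'.+1 then (j, n') :: l' else l')
    else (j, n) :: decr i l'
  else [::].

Definition push i l := if exposed i l then incr i l else (i, 0%N) :: l.

Definition height l := (\sum_(b <- l) b.2.+1)%N.

Lemma exposed_incr i j l : exposed j (incr i l) = exposed j l.
Proof.
elim: l => [|[k n] l IH] //=.
by case: ifP => _ //=; rewrite IH.
Qed.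

Lemma reduced_incr i l : reduced (incr i l) = reduced l.
Proof.
elim: l => [|[k n] l IH] //=.
by case: ifP => _ //=; rewrite IH exposed_incr.
Qed.

Lemma exposed_decr i j l : E j i -> exposed j (decr i l) = exposed j l.
Proof.
move=> Eji; elim: l => [|[k n] l IH] //=.
case: eqP => [->|_] /=; last by rewrite IH.
case: n => [|n] /=; rewrite ?Eji //.
by case: eqP Eji => // ->; rewrite Eirr.
Qed.

(** Deleting a block could let two others merge, but every block in front of an exposed [i] is
    adjacent to [i], hence was never separated by it. *)
Lemma reduced_decr i l : reduced l -> exposed i l -> reduced (decr i l).
Proof.
elim: l => [|[k n] l IH] //= /andP[kl rl].
case: eqP => [e _|_ /= /andP[Eik il]] /=.
  by case: n => //= n; rewrite kl.
by rewrite exposed_decr ?kl ?IH // Esym.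
Qed.

Lemma reduced_push i l : reduced l -> reduced (push i l).
Proof.
by move=> rl; rewrite /push; case: ifP => il; rewrite ?reduced_incr //= il.
Qed.

Lemma height_push i l : height (push i l) = (height l).+1.
Proof.
rewrite /push; case: ifP => il; last by rewrite /height big_cons.
elim: l il => [|[k n] l IH] //=.
case: eqP => [_ _|_ /= /andP[_ il]]; rewrite /height !big_cons //=.
by rewrite -/(height (incr i l)) IH // addnS.
Qed.

Lemma height_decr i l : exposed i l -> height l = (height (decr i l)).+1.
Proof.
elim: l => [|[k n] l IH] //=.
case: eqP => [_ _|_ /= /andP[_ il]].
  by case: n => [|n]; rewrite /height !big_cons.
by rewrite /height !big_cons /= -/(height l) IH // addnS.
Qed.

(** Whichever letter occurs first, the other must commute past it to reach the front. *)
Lemma exposed_adj i j l : exposed i l -> exposed j l -> i != j -> E i j.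
Proof.
move=> il jl; elim: l il jl => [|[k n] l IH] //=.
case: eqP => [<-|_] /=; case: eqP => [<-|_] //=.
- by move=> _ /andP[]; rewrite Esym.
- by move=> /andP[].
- by move=> /andP[_ il] /andP[_ jl]; apply: IH.
Qed.

Lemma card_exposed l : (#|[set i | exposed i l]| <= height l)%N.
Proof.
apply: (@leq_trans (size [seq b.1 | b <- l])).
  apply: leq_trans (card_size _); apply: subset_leq_card.
  apply/fintype.subsetP => i; rewrite inE.
  elim: l => [|[k n] l IH] //= /orP[/eqP->|/andP[_ /IH il]];
    rewrite inE ?eqxx //.
  by rewrite il orbT.
by rewrite size_map /height -sum1_size leq_sum.
Qed.

Lemma not_exposed_blocked (d : I * nat) i l (j : nat) :
  ~~ exposed i l -> (j < size l)%N ->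
  (nth d l j).1 = i -> exists2 k, (k < j)%N & ~~ E i (nth d l k).1.
Proof.
elim: l j => [|b l IH] [|j] //=; rewrite negb_or negb_and.
  by move=> /andP[/eqP bi _] _ /bi.
case/andP => _ /orP[bl _ _|]; first by exists 0%N.
by move=> il jl /(IH _ il jl)[k kj ?]; exists k.+1.
Qed.

(** Puts reducedness in the form of the index condition of [G_independent]; [d] is only the default
    of [nth]. *)
Lemma reduced_blocked (d : I * nat) l (j1 j2 : nat) : reduced l ->
  (j1 < j2 < size l)%N -> (nth d l j1).1 = (nth d l j2).1 ->
  exists2 j3, (j1 < j3 < j2)%N & ~~ E (nth d l j1).1 (nth d l j3).1.
Proof.
elim: l j1 j2 => [|b l IH] j1 j2; first by rewrite andbF.
case: j2 => [|j2] //= /andP[bl rl].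
case: j1 => [|j1] /= jj e.
  have [k kj nE] := not_exposed_blocked bl jj (esym e).
  by exists k.+1.
by have [k kj nE] := IH _ _ rl jj e; exists k.+1.
Qed.

Section Weight.
Variables (K : comNzRingType) (c : I -> K).

Definition weight l := \prod_(b <- l) c b.1 ^+ b.2.+1.

Lemma weight_push i l : weight (push i l) = c i * weight l.
Proof.
rewrite /push; case: ifP => il; last by rewrite /weight big_cons expr1.
elim: l il => [|[k n] l IH] //=.
case: eqP => [-> _|_ /= /andP[_ il]]; rewrite /weight !big_cons /=.
  by rewrite exprS mulrA.
by rewrite -/(weight (incr i l)) IH // mulrCA.
Qed.

Lemma weight_decr i l : exposed i l -> weight l = c i * weight (decr i l).
Proof.
elim: l => [|[k n] l IH] //=.
case: eqP => [-> _|_ /= /andP[_ il]].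
  by case: n => [|n]; rewrite /weight !big_cons /= ?expr1 // exprS mulrA.
by rewrite /weight !big_cons /= -/(weight l) IH // mulrCA.
Qed.

End Weight.
End Blocks.

(** * The trace: linearity, positivity, and its values on Chebyshev polynomials *)

Section CStarAlgebra.
Variables (R : realType) (A : lalgType R[i]) (S : CStarProb R A).
Local Notation C := R[i].
Implicit Types (x y : A) (c : C).

(* An [lalgType] only provides c (x y) = (c x) y; the involution gives the
   other half of bilinearity. *)
Lemma scalerAr_star c x y : x * (c *: y) = c *: (x * y).
Proof.
rewrite -[LHS](star_invol S) star_mul star_scale -scalerAl star_scale conjCK.
by rewrite -star_mul star_invol.
Qed.

Lemma tau0 : tau S 0 = 0.
Proof. by rewrite -[0 in LHS](scale0r (1 : A)) tau_scale mul0r. Qed.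

Lemma tauB x y : tau S (x - y) = tau S x - tau S y.
Proof. by rewrite -[- y]scaleN1r tau_add tau_scale mulN1r. Qed.

Lemma tau_sum (I : finType) (f : I -> A) :
  tau S (\sum_i f i) = \sum_i tau S (f i).
Proof. exact: (big_morph (tau S) (tau_add S) tau0). Qed.

Lemma star_sum (I : finType) (f : I -> A) :
  star S (\sum_i f i) = \sum_i star S (f i).
Proof.
apply: (big_morph (star S) (star_add S)).
by rewrite -[0 in LHS](scale0r (0 : A)) star_scale conjC0 scale0r.
Qed.

Lemma star_exprXX n x : star S ((x * star S x) ^+ n) = (x * star S x) ^+ n.
Proof.
elim: n => [|n IH].
  rewrite expr0 -[LHS]mulr1 -[X in _ * X](star_invol S) -star_mul mulr1.
  exact: star_invol.
by rewrite exprS star_mul IH star_mul star_invol -exprSr exprS.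
Qed.

Lemma tau_exprXX_ge0 n x : 0 <= tau S ((x * star S x) ^+ n).
Proof.
suff [y ->] : exists y, (x * star S x) ^+ n = star S y * y by exact: tau_pos.
(* An even power is the square of a self-adjoint element; in an odd power the middle x x^* is split
   between the two factors. *)
rewrite -(odd_double_half n) -addnn; set q := n./2.
case: (odd n); last by exists ((x * star S x) ^+ q); rewrite star_exprXX -exprD.
exists (star S x * (x * star S x) ^+ q).
by rewrite star_mul star_exprXX star_invol addnCA exprD add1n exprS !mulrA.
Qed.

Lemma gen_star_alg_cheb x n : gen_star_alg S x (cheb x n).
Proof.
elim/nat_ind2: n => [||n [n0 [c0 [w0 e0]]] [n1 [c1 [w1 e1]]]].
- exists 1%N, (fun=> 1), (fun=> [::]).
  by rewrite big_ord1 /word big_nil scale1r.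
- exists 1%N, (fun=> 1), (fun=> [:: false]).
  by rewrite big_ord1 /word big_seq1 scale1r.
- exists (n1 + n0)%N.
  exists (fun j => match fintype.split j with
                   | inl k => c1 k | inr k => - c0 k end).
  exists (fun j => match fintype.split j with
                   | inl k => false :: w1 k | inr k => w0 k end).
  rewrite chebSS e0 e1 big_split_ord /= mulr_sumr -sumrN; congr (_ + _).
    apply: eq_bigr => j _; rewrite (unsplitK (inl j)).
    by rewrite /word big_cons scalerAr_star.
  by apply: eq_bigr => j _; rewrite (unsplitK (inr j)) scaleNr.
Qed.

(** The spare power [x ^+ j] absorbs the factor [x] of the recurrence, so induction on [n] uses only
    the moments of [x]. *)
Lemma tau_mul_cheb x n j : semicircular S x ->
  tau S (x ^+ j * cheb x n) =
  (\int[lebesgue_measure]_(t in `[(-2 : R), 2]%classic)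
     (t ^+ j * cheb t n * semicircle_density t))%:C%C.
Proof.
move=> [_ sx]; elim/nat_ind2: n j => [j|j|n IH0 IH1 j].
- rewrite mulr1 sx; congr (Complex _ _); apply: eq_Rintegral => t _.
  by rewrite mulr1 mulrA.
- rewrite -exprSr sx; congr (Complex _ _); apply: eq_Rintegral => t _.
  by rewrite -exprSr mulrA.
- have int k m : lebesgue_measure.-integrable `[(-2 : R), 2]%classic
      (EFin \o (fun t : R => t ^+ k * cheb t m * semicircle_density t)).
    apply: integrable_density => t.
    by apply: cvgM; [exact: exprn_continuous | exact: continuous_cheb].
  rewrite chebSS mulrBr mulrA -exprSr tauB IH0 IH1 -rmorphB /=.
  rewrite -RintegralB; [| exact: measurable_itv | exact: int | exact: int].
  congr (Complex _ _); apply: eq_Rintegral => t _.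
  by rewrite chebSS exprSr; ring.
Qed.

Lemma tau_cheb x n : semicircular S x -> tau S (cheb x n.+1) = 0.
Proof.
move=> sx; have := @tau_mul_cheb x n.+1 0 sx; rewrite mul1r => ->.
have -> : \int[lebesgue_measure]_(t in `[(-2 : R), 2]%classic)
    (t ^+ 0 * cheb t n.+1 * semicircle_density t) = 0.
  rewrite -[RHS](integral_cheb R n).
  by apply: eq_Rintegral => t _; rewrite mul1r.
by [].
Qed.

End CStarAlgebra.

(** * The moment bound for general charges on the letters *)

Section Independent.
Variables (R : realType) (A : lalgType R[i]) (S : CStarProb R A).
Variables (L : nat) (E : rel 'I_L).
Hypotheses (Esym : symmetric E) (Eirr : irreflexive E).
Variable s : 'I_L -> A.
Hypothesis hsc : forall i, semicircular S (s i).
Hypothesis hind : G_independent S E (fun i => gen_star_alg S (s i)).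
Local Notation C := R[i].
Implicit Types (l : seq ('I_L * nat)) (i j : 'I_L).

Definition cheb_prod l : A := \prod_(b <- l) cheb (s b.1) b.2.+1.

(** Each block is centered by [tau_cheb], and reducedness supplies the index condition of the free
    clause. *)
Lemma tau_cheb_prod l : reduced E l -> tau S (cheb_prod l) = (l == [::])%:R.
Proof.
move=> rl; case: l rl => [|b0 l0]; first by rewrite /cheb_prod big_nil tau1.
move e : (b0 :: l0) => l rl; have l0' : (0 < size l)%N by rewrite -e.
have -> : (l == [::]) = false by rewrite -e.
have [_ hfree] := hind.
rewrite /cheb_prod big_tnth mulr0n.
pose a (j : 'I_(size l)) := tnth (in_tuple l) j.
apply: (hfree _ (fun r => (a r).1) (fun r => cheb (s (a r).1) (a r).2.+1)) =>
  // [j1 j2 j12 ej|j].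
  have b1 := ltn_ord j1; have b2 := ltn_ord j2.
  rewrite /a !(tnth_nth b0) /= in ej.
  have [|j3 j3j nE] := reduced_blocked rl _ ej; first by rewrite j12.
  have b3 : (j3 < size l)%N by move/andP: j3j => [_ /ltn_trans]; exact.
  by exists (Ordinal b3); rewrite /a !(tnth_nth b0).
by split; [exact: gen_star_alg_cheb | exact: tau_cheb].
Qed.

Lemma cheb_prod_push i l : s i * cheb_prod l =
  cheb_prod (push E i l) + (if exposed E i l then cheb_prod (decr i l) else 0).
Proof.
rewrite /push; case: ifP => il; last by rewrite addr0 /cheb_prod big_cons.
elim: l il => [|[k n] l IH] //=.
case: eqP => [-> _|_ /= /andP[Eik il]]; rewrite /cheb_prod big_cons /= mulrA.
  rewrite mul_cheb mulrDl big_cons; congr (_ + _).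
  by case: n => [|n]; rewrite ?big_cons // mul1r.
have [hcl _] := hind.
(* [cheb (s i) 1] is [s i] by computation, so the classical clause moves [s i] past the block of
   [k]. *)
have [-> _] := hcl _ _ Eik _ _ (gen_star_alg_cheb S (s i) 1)
  (gen_star_alg_cheb S (s k) n.+1).
by rewrite -mulrA -/(cheb_prod l) IH // mulrDr !big_cons.
Qed.

Variable alpha : 'I_L -> C.
Let X := \sum_(i < L) alpha i *: s i.

(** The charges [m] are kept abstract to treat both entries of the minimum at once. *)
Variables (m : 'I_L -> C) (p : nat).
Hypothesis m_gt0 : forall i, 0 < m i.
Hypothesis sum_exposed : forall l, reduced E l -> (height l <= p)%N ->
  \sum_(i | exposed E i l) (m i)^-1 <= 1.

Let T := \sum_(i < L) `|alpha i| ^+ 2 * m i.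
Let wt := weight (fun i => `|alpha i| * m i).

Let T_ge0 : 0 <= T.
Proof. by apply: sumr_ge0 => i _; rewrite mulr_ge0 // ?exprn_ge0 // ltW. Qed.

Let wt_ge0 l : 0 <= wt l.
Proof. by apply: prodr_ge0 => b _; rewrite exprn_ge0 // mulr_ge0 // ltW. Qed.

Lemma tau_word_mul (b : bool) y l :
  `|tau S (y * ((if b then star S X else X) * cheb_prod l))| <=
  \sum_(i < L) `|alpha i| * (`|tau S (y * cheb_prod (push E i l))| +
     (if exposed E i l then `|tau S (y * cheb_prod (decr i l))| else 0)).
Proof.
(* Taking the adjoint only conjugates the coefficients, so the moduli do not depend on [b]. *)
pose c i := if b then (alpha i)^* else alpha i.
have -> : (if b then star S X else X) = \sum_(i < L) c i *: s i.
  rewrite /c; case: (b) => //; rewrite star_sum; apply: eq_bigr => i _.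
  by rewrite star_scale (hsc i).1.
rewrite mulr_suml mulr_sumr tau_sum; apply: le_trans (ler_norm_sum _ _ _) _.
apply: ler_sum => i _.
rewrite -scalerAl (scalerAr_star S) tau_scale normrM.
have -> : `|c i| = `|alpha i| by rewrite /c; case: (b); rewrite ?norm_conjC.
rewrite ler_wpM2l // cheb_prod_push mulrDr tau_add.
apply: le_trans (ler_normD _ _) _; rewrite lerD2l.
by case: ifP => // _; rewrite mulr0 tau0 normr0.
Qed.

(* Each factor s_i either opens a new letter or closes an exposed one. An
   opened letter i is charged |alpha_i|^2 m_i in advance; a closing step then
   costs the sum of 1 / m_i over the exposed letters, which is at most 1. *)
Lemma tau_word_bound w l : reduced E l -> (size w + height l <= p.*2)%N ->
  `|tau S (word S X w * cheb_prod l)| <=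
  (ballot (size w) (height l))%:R * wt l * T ^+ ((size w - height l)./2).
Proof.
elim/last_ind: w l => [|w b IH] l rl.
  move=> _; rewrite /word big_nil mul1r tau_cheb_prod //.
  case: l rl => [|[i n] l] _ /=.
    by rewrite /height /wt /weight !big_nil normr1 !mul1r.
  by rewrite normr0 !mulr_ge0 ?exprn_ge0.
rewrite size_rcons => wl.
rewrite /word -cats1 big_cat big_seq1 /= -/(word _ _ _) -mulrA.
apply: le_trans (tau_word_mul _ _ _) _.
(* [U] and [V] carry the ascending and the descending term of the ballot recurrence. *)
set k := size w in IH wl *; set h := height l in wl *.
set U := (ballot k h.+1)%:R * wt l * T ^+ ((k - h.+1)./2).
set V := (if h is h'.+1 then (ballot k h')%:R else 0) * wt l *
  T ^+ ((k.+1 - h)./2).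
have V_ge0 : 0 <= V by rewrite !mulr_ge0 ?exprn_ge0 //; case: (h).
apply: (@le_trans _ _ (\sum_(i < L) (U * (`|alpha i| ^+ 2 * m i)) +
    \sum_(i | exposed E i l) V * (m i)^-1)).
  rewrite [X in _ + X]big_mkcond -big_split /=; apply: ler_sum => i _.
  rewrite mulrDr; apply: lerD.
    have -> : U * (`|alpha i| ^+ 2 * m i) = `|alpha i| *
        ((ballot k h.+1)%:R * wt (push E i l) * T ^+ ((k - h.+1)./2)).
      by rewrite /wt weight_push /U /wt expr2; ring.
    rewrite ler_wpM2l //.
    have := IH (push E i l); rewrite height_push; apply.
      exact: reduced_push.
    by rewrite addnS -addSn.
  case: ifP => il; last by rewrite mulr0.
  have hd := height_decr il.
  have -> : V / m i = `|alpha i| *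
      ((ballot k (height (decr i l)))%:R * wt (decr i l) *
       T ^+ ((k - height (decr i l))./2)).
    rewrite /V /h hd subSS /wt (weight_decr _ il).
    by field; rewrite gt_eqF.
  rewrite ler_wpM2l //; apply: IH; first exact: reduced_decr.
  by move: wl; rewrite /h hd; lia.
rewrite -mulr_sumr -mulr_sumr -/T /= natrD mulrDl mulrDl lerD //.
  (* Opening a letter contributes one factor [T]. The halved exponents match only when h < k;
     otherwise the ballot number is 0. *)
  rewrite /U; case: (ltnP k h.+1) => kh; first by rewrite ballot_lt // !mul0r.
  rewrite -mulrA -exprSr.
  by have -> : ((k - h.+1)./2.+1 = (k.+1 - h)./2)%N by lia.
have -> : (if h is h'.+1 then ballot k h' else 0%N)%:R * wt l *
    T ^+ ((k.+1 - h)./2) = V.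
  by rewrite /V; case: (h).
(* Above height p [sum_exposed] does not apply, but then too few steps remain to return to 0 and the
   ballot number vanishes. *)
case: (ltnP p h) => hp.
  have -> : V = 0; last by rewrite mul0r.
  rewrite /V; case: (h) hp wl => // h' hp wl.
  by rewrite ballot_lt ?mul0r //; lia.
by rewrite ler_piMr // sum_exposed.
Qed.

Lemma tau_exprXX_bound :
  tau S ((X * star S X) ^+ p) <= (catalan R p)%:C%C * T ^+ p.
Proof.
have XX : (X * star S X) ^+ p =
    word S X (flatten (nseq p [:: false; true])) * cheb_prod [::].
  rewrite /cheb_prod big_nil mulr1; elim: (p) => [|n IH].
    by rewrite /word big_nil.
  by rewrite exprS IH /= /word !big_cons mulrA.
have sz : size (flatten (nseq p [:: false; true])) = p.*2.
  by elim: (p) => //= n ->.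
apply: le_trans (real_ler_norm (ger0_real (tau_exprXX_ge0 S p X))) _.
rewrite XX; apply: le_trans (tau_word_bound _ _) _ => //.
  by rewrite sz /height big_nil addn0.
rewrite sz {1 2}/height big_nil subn0 doubleK -ballot0_catalan rmorph_nat.
by rewrite /wt /weight big_nil mulr1.
Qed.

End Independent.

(** * From the moment bound to the two norm bounds *)

Section Norm.
Variables (R : realType) (A : lalgType R[i]) (S : CStarProb R A).
Variables (L : nat) (E : rel 'I_L).
Hypotheses (Esym : symmetric E) (Eirr : irreflexive E).
Variable s : 'I_L -> A.
Hypothesis hsc : forall i, semicircular S (s i).
Hypothesis hind : G_independent S E (fun i => gen_star_alg S (s i)).
Variables (alpha : 'I_L -> R[i]) (p : nat).
Hypothesis p_gt0 : (0 < p)%N.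

Lemma absC2_ge0 (z : R[i]) : 0 <= absC2 z.
Proof. by rewrite addr_ge0 ?sqr_ge0. Qed.

Lemma norm_sqr_absC2 (z : R[i]) : `|z| ^+ 2 = (absC2 z)%:C%C.
Proof. by rewrite normc_def -rmorphXn /= sqr_sqrtr // absC2_ge0. Qed.

Lemma norm2p_bound (m : 'I_L -> nat) :
  (forall i, 0 < m i)%N ->
  (forall l, (height l <= p)%N -> forall i, exposed E i l ->
     (#|[set j | exposed E j l]| <= m i)%N) ->
  norm2p S (\sum_(i < L) alpha i *: s i) p <=
  catalan R p `^ (p.*2%:R)^-1 *
  Num.sqrt (\sum_(i < L) absC2 (alpha i) * (m i)%:R).
Proof.
move=> m_gt0 hm; set T : R := \sum_(i < L) _.
have T_ge0 : 0 <= T by apply: sumr_ge0 => i _; rewrite mulr_ge0 ?absC2_ge0.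
have cat_ge0 : 0 <= catalan R p by rewrite divr_ge0.
have m_gt0C i : 0 < (m i)%:R :> R[i] by rewrite ltr0n.
have sum_exposed l : reduced E l -> (height l <= p)%N ->
    \sum_(i | exposed E i l) (m i)%:R^-1 <= 1 :> R[i].
  move=> _ hl; set K := [set j | exposed E j l].
  (* Each exposed [i] has charge at least #|K|, so the sum is at most #|K| terms 1 / #|K|; it is 0
     when [K] is empty. *)
  apply: (@le_trans _ _ (\sum_(i in K) (#|K|%:R)^-1)).
    rewrite big_mkcond [leRHS]big_mkcond /=; apply: ler_sum => i _.
    rewrite inE; case: ifP => // il.
    have K0 : (0 < #|K|)%N by apply/card_gt0P; exists i; rewrite inE.
    by rewrite lef_pV2 ?posrE ?ltr0n // ler_nat hm.
  rewrite sumr_const -[leLHS]mulr_natr.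
  by case: #|K| => [|n]; rewrite ?mulr0 ?ler01 // mulVf ?pnatr_eq0.
have := tau_exprXX_bound Esym Eirr hsc hind alpha m_gt0C sum_exposed.
have -> : \sum_(i < L) `|alpha i| ^+ 2 * (m i)%:R = T%:C%C.
  rewrite /T rmorph_sum; apply: eq_bigr => i _.
  by rewrite rmorphM rmorph_nat norm_sqr_absC2.
rewrite -rmorphXn -rmorphM /= lecE => /andP[_ le_tau].
have tau_ge0 := tau_exprXX_ge0 S p (\sum_(i < L) alpha i *: s i).
move: tau_ge0; rewrite lecE => /andP[_ tau_ge0].
rewrite /norm2p.
apply: le_trans (ge0_ler_powR _ _ _ le_tau) _;
  rewrite ?nnegrE ?mulr_ge0 ?exprn_ge0 //.
rewrite powRM ?exprn_ge0 // -powR_mulrn // -powRrM.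
(* The exponent p / (2p) = 1/2 turns the power of [T] into a square root. *)
rewrite -muln2 natrM invfM mulrA mulfV ?pnatr_eq0 -?lt0n // mul1r.
by rewrite powR12_sqrt.
Qed.

(** Charge |c^*(i)|: the exposed letters form a clique, which contains [i] when [i] is exposed.
    Singleton cliques make the charge positive. *)
Lemma norm2p_maxclique :
  norm2p S (\sum_(i < L) alpha i *: s i) p <=
  catalan R p `^ (p.*2%:R)^-1 *
  Num.sqrt (\sum_(i < L) absC2 (alpha i) * (maxclique_at E i)%:R).
Proof.
apply: norm2p_bound => [i | l _ i il].
  apply: (@leq_trans #|[set i]|); first by rewrite cards1.
  apply: (@leq_bigmax_cond _ _ (fun K : {set 'I_L} => #|K|)).
  rewrite inE eqxx andbT; apply/forall_inP => x /set1P ->.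
  by apply/forall_inP => y /set1P ->; rewrite eqxx.
apply: (@leq_bigmax_cond _ _ (fun K : {set 'I_L} => #|K|)).
rewrite inE il andbT.
apply/forall_inP => x; rewrite inE => xl.
apply/forall_inP => y; rewrite inE => yl.
by apply/implyP; exact: (exposed_adj Esym xl yl).
Qed.

(** Constant charge p: at most as many letters are exposed as the height allows. *)
Lemma norm2p_le_order :
  norm2p S (\sum_(i < L) alpha i *: s i) p <=
  catalan R p `^ (p.*2%:R)^-1 *
  Num.sqrt (p%:R * \sum_(i < L) absC2 (alpha i)).
Proof.
rewrite [p%:R * _]mulrC mulr_suml.
apply: norm2p_bound => // l lp i _; exact: leq_trans (card_exposed _ _) lp.
Qed.

End Norm.

Lemma maxclique_le_clique_number (L : nat) (E : rel 'I_L) (i : 'I_L) :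
  (maxclique_at E i <= clique_number E)%N.
Proof.
apply/bigmax_leqP => K /andP[cK _].
exact: (@leq_bigmax_cond _ _ (fun K : {set 'I_L} => #|K|)).
Qed.

Theorem theorem1p1 (R : realType) (A : lalgType R[i]) (S : CStarProb R A)
  (L : nat) (E : rel 'I_L) (Esym : symmetric E) (Eirr : irreflexive E)
  (s : 'I_L -> A)
  (hsc : forall i, semicircular S (s i))
  (hind : G_independent S E (fun i => gen_star_alg S (s i)))
  (alpha : 'I_L -> R[i]) (p : nat) (hp : (0 < p)%N) :
  norm2p S (\sum_(i < L) alpha i *: s i) p <=
    catalan R p `^ (p.*2%:R)^-1 *
    Num.sqrt (Num.min (\sum_(i < L) absC2 (alpha i) * (maxclique_at E i)%:R)
                      (p%:R * \sum_(i < L) absC2 (alpha i)))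
  /\
  norm2p S (\sum_(i < L) alpha i *: s i) p <=
    catalan R p `^ (p.*2%:R)^-1 *
    Num.sqrt (Num.min (clique_number E)%:R p%:R) *
    Num.sqrt (\sum_(i < L) absC2 (alpha i)).
Proof.
have maxc := norm2p_maxclique Esym Eirr hsc hind alpha hp.
have deg := norm2p_le_order Esym Eirr hsc hind alpha hp.
split; first by rewrite /Num.min; case: ifP.
rewrite -mulrA -sqrtrM; last by rewrite le_min !ler0n.
(* If p is the minimum, [deg] is the claim; otherwise each |c^*(i)| is bounded by the clique
   number. *)
rewrite /Num.min; case: ifP => // _.
apply: le_trans maxc _; rewrite ler_wpM2l ?powR_ge0 // ler_wsqrtr //.
rewrite mulr_sumr; apply: ler_sum => i _.
by rewrite mulrC ler_wpM2r ?absC2_ge0 // ler_nat maxclique_le_clique_number.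
Qed.
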